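(* Let $\mathcal{D}$ be a probability distribution over a domain $\mathcal{X}$, let $c:\mathcal{X}\to\{-1,+1\}$ be any binary classifier, and let $g:\mathcal{X}\to\{-1,+1\}$ be any member of a collection $\mathcal{G}$ of (indicators of) subgroups, with $\Pr_{x\sim\mathcal{D}}\{g(x)=1\}>0$. Then, with all probabilities over $x\sim\mathcal{D}$, $$2\Pr\{g(x)=1\}\,d_{\mathcal{D}}(c,g)=\Pr\{c(x)=-1\}\Pr\{g(x)=-1\}+\Pr\{c(x)=1\}\Pr\{g(x)=1\}-\Pr\{c(x)=g(x)\}.$$
   Context: For a classifier $c$ and a subgroup indicator $g$ (the subgroup being $\{x:g(x)=1\}$), $d_{\mathcal{D}}(c,g)=\Pr_{x\sim\mathcal{D}}\{c(x)=1\}-\Pr_{x\sim\mathcal{D}}\{c(x)=1\mid g(x)=1\}$. *)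

(* Defs.v *)
From HB Require Import structures.
From mathcomp Require Import all_boot all_order all_algebra.
From mathcomp Require Import all_classical all_reals all_analysis.
Set Implicit Arguments.
Unset Strict Implicit.
Unset Printing Implicit Defensive.
Import Order.TTheory GRing.Theory Num.Theory.
Import numFieldNormedType.Exports.
Local Open Scope classical_set_scope.
Local Open Scope ring_scope.

(* Labels are the reals -1 and +1.  Measurability makes every event below
   (f = 1, f = -1, f = f') an event of the probability space. *)
Definition sign_classifier (d : measure_display) (X : measurableType d)
    (R : realType) (f : X -> R) : Prop :=
  measurable_fun setT f /\ forall x, f x = -1 \/ f x = 1.

(* Real-valued probability; no information is lost, as D A is finite. *)
Definition Pr (d : measure_display) (X : measurableType d) (R : realType)
    (D : probability X R) (A : set X) : R := fine (D A).

(* Only meaningful when 0 < Pr D B (the value is 0 when Pr D B = 0). *)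
Definition condPr (d : measure_display) (X : measurableType d) (R : realType)
    (D : probability X R) (A B : set X) : R := Pr D (A `&` B) / Pr D B.

Definition disparity (d : measure_display) (X : measurableType d)
    (R : realType) (D : probability X R) (c g : X -> R) : R :=
  Pr D [set x | c x = 1] - condPr D [set x | c x = 1] [set x | g x = 1].

(* Main.v *)
Require Import Defs.
From HB Require Import structures.
From mathcomp Require Import all_boot all_order all_algebra.
From mathcomp Require Import all_classical all_reals all_analysis.
From mathcomp Require Import ring.
Set Implicit Arguments.
Unset Strict Implicit.
Unset Printing Implicit Defensive.
Import Order.TTheory GRing.Theory Num.Theory.
Import numFieldNormedType.Exports.
Local Open Scope classical_set_scope.
Local Open Scope ring_scope.

(** Both sides are polynomials in p = Pr(c = 1), q = Pr(g = 1) and r = Pr(c = 1 and g = 1). As q >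
    0, the left side is 2q(p - r/q) = 2pq - 2r. Agreement means both labels are 1 or both are -1, so
    by inclusion-exclusion it has probability r + (1 - p - q + r), and the right side is also 2pq -
    2r. [sign_classifier_agree] gives the splitting; [PrU], [PrC] and [PrIC] evaluate it. *)

Lemma PrU (d : measure_display) (X : measurableType d) (R : realType)
    (D : probability X R) (A B : set X) :
  measurable A -> measurable B -> A `&` B = set0 ->
  Pr D (A `|` B) = Pr D A + Pr D B.
Proof.
by move=> mA mB AB0; rewrite /Pr measureU// fineD// fin_num_measure.
Qed.

Lemma PrC (d : measure_display) (X : measurableType d) (R : realType)
    (D : probability X R) (A : set X) :
  measurable A -> Pr D (~` A) = 1 - Pr D A.
Proof.
by move=> mA; rewrite /Pr probability_setC// fineB// fin_num_measure.
Qed.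

Lemma PrIC (d : measure_display) (X : measurableType d) (R : realType)
    (D : probability X R) (A B : set X) :
  measurable A -> measurable B ->
  Pr D (A `&` ~` B) = Pr D A - Pr D (A `&` B).
Proof.
(* Moving the subtracted term across turns the claim into additivity for [A] cut along [B]. *)
move=> mA mB; apply/eqP; rewrite eq_sym subr_eq -PrU.
- by rewrite -setIUr setUC setUv setIT.
- by apply: measurableI => //; exact: measurableC.
- exact: measurableI.
- by rewrite setIACA setICl setI0.
Qed.

Lemma sign_classifier_measurable (d : measure_display) (X : measurableType d)
    (R : realType) (f : X -> R) :
  sign_classifier f -> measurable [set x | f x = 1].
Proof.
move=> [mf _]; rewrite (_ : [set x | _] = setT `&` f @^-1` [set 1]).
  exact: mf.
by rewrite setTI.
Qed.

Lemma sign_classifier_setC (d : measure_display) (X : measurableType d)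
    (R : realType) (f : X -> R) :
  sign_classifier f -> [set x | f x = -1] = ~` [set x | f x = 1].
Proof.
move=> [_ f_sign]; apply/seteqP; split=> x /= => [-> |]; last first.
  by have [|] := f_sign x.
by move/eqP; rewrite eqNr oner_eq0.
Qed.

(** With only two labels, agreeing means both are 1 or neither is. Using complements instead of the
    label -1 leaves only two basic events to measure. *)
Lemma sign_classifier_agree (d : measure_display) (X : measurableType d)
    (R : realType) (f g : X -> R) :
  sign_classifier f -> sign_classifier g ->
  [set x | f x = g x] = ([set x | f x = 1] `&` [set x | g x = 1]) `|`
    (~` [set x | f x = 1] `&` ~` [set x | g x = 1]).
Proof.
move=> hf hg; rewrite -!sign_classifier_setC//.
apply/seteqP; split=> x /= => [fg|[[-> ->]//|[-> ->]//]].
by have [fx|fx] := hf.2 x; [right|left]; rewrite -fg.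
Qed.

Theorem lemma3p4 (d : measure_display) (X : measurableType d) (R : realType)
    (D : probability X R) (c : X -> R) (hc : sign_classifier c)
    (G : set (X -> R)) (hG : forall g : X -> R, G g -> sign_classifier g)
    (g : X -> R) (hg : G g) (hg0 : 0 < Pr D [set x | g x = 1]) :
  2 * Pr D [set x | g x = 1] * disparity D c g =
  Pr D [set x | c x = -1] * Pr D [set x | g x = -1]
  + Pr D [set x | c x = 1] * Pr D [set x | g x = 1]
  - Pr D [set x | c x = g x].
Proof.
have hg1 := hG g hg.
have mC := sign_classifier_measurable hc.
have mB := sign_classifier_measurable hg1.
rewrite (sign_classifier_agree hc hg1) !sign_classifier_setC// /disparity /condPr.
move: mC mB hg0; set C := [set x | c x = 1]; set B := [set x | g x = 1].
move=> mC mB hB.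
have [mC' mB'] := (measurableC mC, measurableC mB).
rewrite PrU; [|exact: measurableI..|by rewrite setIACA setICr set0I].
(* Two uses of [PrIC] expand Pr(not C, not B) to (1 - p) - (q - r); the final commutation makes both
   occurrences of r syntactically equal. *)
rewrite PrIC// (setIC (~` C)) PrIC// !PrC// (setIC B).
(* Positivity of Pr B discharges the nonzero denominator coming from [condPr]. *)
by field; rewrite gt_eqF.
Qed.
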